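(* Let $\mathbf{A}\in\mathbb{C}^{N\times N}$, let $\Pi=(c_1,\ldots,c_k)$ be a partition of $\{1,\ldots,N\}$ into consecutive cells (suitable indexing), and let $\mathbf{w}\in\mathbb{C}^N$ be such that the weighted indicator matrix $\mathbf{W}=\operatorname{diag}(\mathbf{w}_1,\ldots,\mathbf{w}_k)\in\mathbb{C}^{N\times k}$ is admissible. Let $\mathbf{E}^{\alpha}$ be the generalized quotients and $\mathbf{T}^{\pm}$ the deviation matrices of $\mathbf{A}$ w.r.t. $\mathbf{W}$. Let $\mathbf{V}=\operatorname{diag}(\beta_1,\ldots,\beta_k)$ be a unitary diagonal matrix, let $\tilde{\mathbf{H}}=\operatorname{diag}(\mathbf{H}(\mathbf{w}_1,\beta_1),\ldots,\mathbf{H}(\mathbf{w}_k,\beta_k))$, and let $\mathbf{\Omega}$ be the permutation matrix corresponding to $\Omega_{(|c_1|,\ldots,|c_k|)}$. Let $\tilde{\mathbf{A}}=\tilde{\mathbf{H}}^*\mathbf{A}\tilde{\mathbf{H}}$, whose $(i,j)$ block is $\tilde{\mathbf{A}}_{ij}=\mathbf{H}(\mathbf{w}_i,\beta_i)^*\mathbf{A}_{ij}\mathbf{H}(\mathbf{w}_j,\beta_j)$, and write $$\hat{\mathbf{A}}=\mathbf{\Omega}^*\tilde{\mathbf{A}}\mathbf{\Omega}=\begin{pmatrix}\mathbf{E}&(\mathbf{D}^{+})^*\\ \mathbf{D}^{-}&\mathbf{F}\end{pmatrix}\quad\text{with }\mathbf{E}\in\mathbb{C}^{k\times k}.$$ Then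 $\hat{\mathbf{A}}$ is unitarily similar to $\mathbf{A}$, $\mathbf{E}$ is unitarily similar to the Rayleigh quotient $\mathbf{E}^0$, and $\mathbf{D}^{-}$ and $\mathbf{D}^{+}$ have the same singular values as $\mathbf{T}^{-}$ and $\mathbf{T}^{+}$, respectively. Moreover, any eigenvector $\hat{\mathbf{z}}$ of $\hat{\mathbf{A}}$ yields an eigenvector $\mathbf{z}=\tilde{\mathbf{H}}\mathbf{\Omega}\hat{\mathbf{z}}$ of $\mathbf{A}$ for the same eigenvalue.
   Context: $\mathbf{X}^*$ denotes the conjugate transpose; $\mathbf{f}_n=(1,0,\ldots,0)^T\in\mathbb{C}^n$. Let $n_i=|c_i|$; suitable indexing means that for $u\in c_i$, $v\in c_j$, $i<j$ implies $u<v$, so cells are consecutive index blocks and $\mathbf{A}$ is partitioned into blocks $\mathbf{A}_{ij}\in\mathbb{C}^{n_i\times n_j}$. $\mathbf{w}_i\in\mathbb{C}^{n_i}$ is the subvector of $\mathbf{w}$ indexed by $c_i$; $\mathbf{W}$ has entries $w_{vi}=w^v$ if $v\in c_i$ and $0$ otherwise (block diagonal with blocks the columns $\mathbf{w}_i$). $\mathbf{W}$ is admissible if $\lVert\mathbf{w}_i\rVert>0$ for all $i$, so $\mathbf{W}^*\mathbf{W}=\operatorname{diag}(\lVert\mathbf{w}_1\rVert^2,\ldots,\lVert\mathbf{w}_k\rVert^2)$ is invertible. For $\alpha\in\mathbb{R}$ the generalized quotient is $\mathbf{E}^{\alpha}=(\mathbf{W}^*\mathbf{W})^{-\frac{1-\alpha}{2}}\mathbf{W}^*\mathbf{A}\mathbf{W}(\mathbf{W}^*\mathbf{W})^{-\frac{1+\alpha}{2}}$;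 $\mathbf{E}^0$ is the Rayleigh quotient, $\mathbf{E}^-=\mathbf{E}^{-1}$, $\mathbf{E}^+=\mathbf{E}^{1}$. The deviation matrices are $\mathbf{T}^{-}=(\mathbf{A}\mathbf{W}-\mathbf{W}\mathbf{E}^{-})(\mathbf{W}^*\mathbf{W})^{-1/2}$ and $\mathbf{T}^{+}=(\mathbf{A}^*\mathbf{W}-\mathbf{W}(\mathbf{E}^{+})^* )(\mathbf{W}^*\mathbf{W})^{-1/2}$, both in $\mathbb{C}^{N\times k}$. For $\mathbf{x}\in\mathbb{C}^n$ with $\lVert\mathbf{x}\rVert>0$, first entry $x^1$, and $\beta\in\mathbb{C}$ with $|\beta|=1$: $\mathbf{H}(\mathbf{x},\beta)=\mathbf{I}_n$ if $\mathbf{x}/\lVert\mathbf{x}\rVert=\overline{\beta}\mathbf{f}_n$, and otherwise $\mathbf{H}(\mathbf{x},\beta)=\mathbf{I}_n+\frac{\mathbf{y}\mathbf{y}^*}{\lVert\mathbf{x}\rVert\overline{\beta}(\overline{x^1}-\lVert\mathbf{x}\rVert\beta)}$ with $\mathbf{y}=\mathbf{x}-\lVert\mathbf{x}\rVert\overline{\beta}\mathbf{f}_n$ (a unitary matrix with $\mathbf{H}(\mathbf{x},\beta)\mathbf{f}_n=\frac{\beta}{\lVert\mathbf{x}\rVert}\mathbf{x}$). For $\mathbf{n}=(n_1,\ldots,n_k)$, the permutation $\Omega_{\mathbf{n}}$ of $\{1,\ldots,N\}$ is given, for $i\in\{1,\ldots,k\}$ and $1\le m_i\le n_i$, by $\Omega_{\mathbf{n}}(m_i+\sum_{j=1}^{i-1}n_j)=i$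 if $m_i=1$ and $=k-i+m_i+\sum_{j=1}^{i-1}n_j$ if $m_i\ge2$ (it sends the first index of each cell to $\{1,\ldots,k\}$, preserving the order of the rest). Its permutation matrix $\mathbf{\Omega}$ has $\mathbf{\Omega}_{u,\Omega_{\mathbf{n}}(u)}=1$, so $(\mathbf{\Omega}^*\tilde{\mathbf{A}}\mathbf{\Omega})_{\Omega_{\mathbf{n}}(u)\Omega_{\mathbf{n}}(v)}=\tilde{a}_{uv}$. *)

(* Defs.v *)
(* Complex numbers are R[i] over an abstract R : realType, so that powR provides
   the real exponents of the generalized quotients. *)
From HB Require Import structures.
From mathcomp Require Import all_boot all_order all_algebra all_fingroup.
From mathcomp Require Import sesquilinear spectral.
From mathcomp Require Import complex.
From mathcomp Require Import reals exp.
From mathcomp Require Import zify.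

Set Implicit Arguments.
Unset Strict Implicit.
Unset Printing Implicit Defensive.

Import Order.TTheory GRing.Theory Num.Theory.
Local Open Scope ring_scope.
Local Open Scope sesquilinear_scope.

(* The last field is the "suitable indexing" convention: it forces the cells to
   be consecutive blocks of indices. *)
Record ordered_partition (N k : nat) := OrderedPartition {
  cell :> 'I_k -> {set 'I_N};
  cell_inj : injective cell;
  cell_partition : partition [set cell i | i : 'I_k] [set: 'I_N];
  cell_sorted : forall (i j : 'I_k) (u v : 'I_N),
    u \in cell i -> v \in cell j -> (i < j)%N -> (u < v)%N
}.

Section OmegaPerm.

Variables (N k : nat) (P : ordered_partition N k).

Lemma cell_neq0 (i : 'I_k) : (0 < #|P i|)%N.
Proof.
have /and3P[_ _ n0] := cell_partition P.
rewrite card_gt0; apply: contra n0 => /eqP <-; exact: imset_f.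
Qed.

Lemma cell_disj (i j : 'I_k) u : u \in P i -> u \in P j -> i = j.
Proof.
move=> ui uj; apply/val_inj/eqP; rewrite eqn_leq leqNgt [(j <= i)%N]leqNgt.
by apply/andP; split; apply/negP => lt;
  [have := cell_sorted uj ui lt | have := cell_sorted ui uj lt];
  rewrite ltnn.
Qed.

Lemma cell_ex (u : 'I_N) : exists i, u \in P i.
Proof.
have /and3P[/eqP covP _ _] := cell_partition P.
have : u \in cover [set P i | i : 'I_k] by rewrite covP inE.
by case/bigcupP => _ /imsetP[i _ ->]; exists i.
Qed.

Definition cell_of (u : 'I_N) : 'I_k := xchoose (cell_ex u).

Lemma mem_cell_of u : u \in P (cell_of u).
Proof. exact: (xchooseP (cell_ex u)). Qed.

Lemma cell_ofE i u : u \in P i -> cell_of u = i.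
Proof. by apply: cell_disj; exact: mem_cell_of. Qed.

Definition cell_start (i : nat) : nat := (\sum_(j < k | (j < i)%N) #|P j|)%N.

Lemma card_cells (Q : pred 'I_k) :
  (\sum_(j < k | Q j) #|P j| = #|[set v | Q (cell_of v)]|)%N.
Proof.
rewrite -[RHS]sum1_card (partition_big cell_of Q) /=; last by move=> u; rewrite inE.
apply: eq_bigr => j Qj; rewrite -sum1_card; apply: eq_bigl => v; rewrite inE.
apply/idP/andP => [vj|[_ /eqP <-]]; last exact: mem_cell_of.
by rewrite (cell_ofE vj).
Qed.

Lemma cell_startS (i : 'I_k) : cell_start i.+1 = (cell_start i + #|P i|)%N.
Proof.
rewrite /cell_start (bigD1 i) ?ltnSn //= addnC; congr addn.
by apply: eq_bigl => j; rewrite ltnS (ltn_neqAle j) andbC.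
Qed.

Lemma cell_start_full : cell_start k = N.
Proof.
rewrite /cell_start card_cells -[RHS]card_ord -cardsT; congr #|pred_of_set _|.
by apply/setP => v; rewrite !inE ltn_ord.
Qed.

Lemma cell_start_mono i j : (i <= j)%N -> (cell_start i <= cell_start j)%N.
Proof.
move=> lij; rewrite /cell_start !card_cells; apply/subset_leq_card/subsetP => v.
by rewrite !inE => /leq_trans; apply.
Qed.

Lemma card_ltn_ord (m : nat) : (m <= N)%N -> #|[set v : 'I_N | (v < m)%N]| = m.
Proof.
move=> mN; rewrite -sum1_card -[RHS]card_ord -sum1_card.
by rewrite (big_ord_widen N (fun=> 1%N) mN); apply: eq_bigl => v; rewrite inE.
Qed.

Lemma cell_of_mono (u v : 'I_N) : (u <= v)%N -> (cell_of u <= cell_of v)%N.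
Proof.
move=> uv; rewrite leqNgt; apply/negP => lt.
by have := cell_sorted (mem_cell_of v) (mem_cell_of u) lt; rewrite ltnNge uv.
Qed.

Lemma cell_of_bounds (u : 'I_N) :
  (cell_start (cell_of u) <= u < cell_start (cell_of u).+1)%N.
Proof.
apply/andP; split.
  rewrite -[leqRHS](card_ltn_ord (ltnW (ltn_ord u))) /cell_start card_cells.
  apply/subset_leq_card/subsetP => v; rewrite !inE => lt.
  exact: cell_sorted (mem_cell_of v) (mem_cell_of u) lt.
rewrite -[X in (X <= _)%N](card_ltn_ord (ltn_ord u)) /cell_start card_cells.
apply/subset_leq_card/subsetP => v; rewrite !inE !ltnS; exact: cell_of_mono.
Qed.

Lemma cell_start_gap i d : (i + d <= k)%N ->
  (cell_start i + d <= cell_start (i + d))%N.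
Proof.
elim: d => [|d IHd]; first by rewrite !addn0.
rewrite addnS => idk; rewrite (cell_startS (Ordinal idk)) /= addnS -addn1.
by rewrite leq_add ?IHd ?cell_neq0 // ltnW.
Qed.

Lemma leq_cells : (k <= N)%N.
Proof.
by rewrite -cell_start_full; apply: leq_trans (@cell_start_gap 0 k _); rewrite ?leq_addl.
Qed.

Lemma cells_addK : (k + (N - k))%N = N.
Proof. exact: subnKC leq_cells. Qed.

(* 0-based form of Omega_n: the index u in the cell i is m + cell_start i, with
   m its 0-based position in the cell (see OmegaE). *)
Definition Omega_nat (u : 'I_N) : nat :=
  let i := cell_of u in
  if u == cell_start i :> nat then i : nat else (k - i.+1 + u)%N.

Lemma Omega_nat_lt u : (Omega_nat u < N)%N.
Proof.
rewrite /Omega_nat; have /andP[le lt] := cell_of_bounds u.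
case: eqP => [_|_]; first exact: leq_trans (ltn_ord _) leq_cells.
have := @cell_start_gap (cell_of u).+1 (k - (cell_of u).+1).
rewrite subnKC ?ltn_ord // => /(_ (leqnn _)); rewrite cell_start_full.
by apply: leq_trans; rewrite addnC ltn_add2r.
Qed.

Definition Omega_fun (u : 'I_N) : 'I_N := Ordinal (Omega_nat_lt u).

Lemma Omega_nat_ge (u : 'I_N) : (u != cell_start (cell_of u) :> nat) ->
  (k <= k - (cell_of u).+1 + u)%N.
Proof.
move=> neq; have /andP[le _] := cell_of_bounds u.
have := @cell_start_gap 0 (cell_of u); rewrite !add0n.
have := ltn_ord (cell_of u); lia.
Qed.

Lemma Omega_nat_mono (u v : 'I_N) : (u < v)%N -> v != cell_start (cell_of v) :> nat ->
  (k - (cell_of u).+1 + u < k - (cell_of v).+1 + v)%N.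
Proof.
move=> uv neq; have /andP[leu ltu] := cell_of_bounds u.
have /andP[lev ltv] := cell_of_bounds v.
have := cell_of_mono (ltnW uv); rewrite leq_eqVlt => /orP[/eqP <-|luv].
  by rewrite ltn_add2l.
have := @cell_start_gap (cell_of u).+1 (cell_of v - (cell_of u).+1).
rewrite subnKC //; have := ltn_ord (cell_of v); lia.
Qed.

Lemma Omega_inj : injective Omega_fun.
Proof.
move=> u v /(congr1 val) /=; rewrite /Omega_nat.
case: eqP => [eu|/eqP nu]; case: eqP => [ev|/eqP nv] E.
- by apply/val_inj; rewrite /= eu ev; congr cell_start.
- by have := Omega_nat_ge nv; rewrite -E leqNgt ltn_ord.
- by have := Omega_nat_ge nu; rewrite E leqNgt ltn_ord.
- apply/val_inj/eqP; rewrite eqn_leq leqNgt [(v <= u)%N]leqNgt.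
  by apply/andP; split; apply/negP => lt;
    [have := Omega_nat_mono lt nu | have := Omega_nat_mono lt nv];
    rewrite E ltnn.
Qed.

Definition Omega_perm : 'S_N := perm Omega_inj.

Lemma OmegaE (i : 'I_k) (m : nat) (u : 'I_N) :
  (m < #|P i|)%N -> u = (m + \sum_(j < k | (j < i)%N) #|P j|)%N :> nat ->
  Omega_perm u = (if m == 0 then (i : nat)
    else k - i.+1 + m + \sum_(j < k | (j < i)%N) #|P j|)%N :> nat.
Proof.
rewrite -[(\sum_(j < k | _) _)%N]/(cell_start i) => mi uE.
have ci : cell_of u = i.
  have /andP[leu ltu] := cell_of_bounds u.
  apply/val_inj/eqP; rewrite eqn_leq leqNgt [(i <= _)%N]leqNgt.
  apply/andP; split; apply/negP => /cell_start_mono.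
    rewrite cell_startS => /leq_trans /(_ leu).
    by rewrite uE addnC leqNgt ltn_add2r mi.
  by move/(leq_trans ltu); rewrite uE ltnNge leq_addl.
rewrite permE /= /Omega_nat ci uE -{2}(add0n (cell_start i)) eqn_add2r.
by case: eqP => // _; rewrite addnA.
Qed.

End OmegaPerm.

Section HouseholderQuotient.

Variable R : realType.
Local Notation C := R[i].

Definition vnorm n (x : 'cV[C]_n) : C := sqrtC (\sum_j `|x j 0| ^+ 2).

Definition fvec n : 'cV[C]_n := \col_j (j == 0%N :> nat)%:R.

(* The value on the empty vector is irrelevant. *)
Definition first_entry n : 'cV[C]_n -> C :=
  if n is n'.+1 return 'cV[C]_n -> C then fun x => x 0 0 else fun=> 0.

Definition householder n (x : 'cV[C]_n) (b : C) : 'M[C]_n :=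
  if (vnorm x)^-1 *: x == b^* *: fvec n then 1%:M
  else let y := x - (vnorm x * b^*) *: fvec n in
    1%:M + (vnorm x * b^* * ((first_entry x)^* - vnorm x * b))^-1
             *: (y *m y ^t*).

(* Entrywise real power of the diagonal, meant for diagonal matrices with
   positive real diagonal entries. *)
Definition diag_pow k (D : 'M[C]_k) (s : R) : 'M[C]_k :=
  diag_mx (\row_i real_complex R (complex.Re (D i i) `^ s)).

(* The roots of the characteristic polynomial, listed with multiplicity. *)
Definition eigenvalues n (M : 'M[C]_n) : seq C :=
  sval (closed_field_poly_normal (char_poly M)).

(* The square roots of the n eigenvalues of M^* M, listed with multiplicity and
   without truncation to min(m, n): matrices with the same number n of columns
   but different numbers of rows can thus have the same singular values. *)
Definition singular_values m n (M : 'M[C]_(m, n)) : seq C :=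
  [seq sqrtC z | z <- eigenvalues (M ^t* *m M)].

Section Quotient.

Variables (N k : nat) (P : ordered_partition N k).
Implicit Types (A : 'M[C]_N) (w : 'cV[C]_N) (b : 'rV[C]_k).

(* enum_val lists the elements of a cell in increasing order. *)
Definition subvec w (i : 'I_k) : 'cV[C]_#|P i| :=
  rowsub (@enum_val _ (mem (P i))) w.

Definition block A (i j : 'I_k) : 'M[C]_(#|P i|, #|P j|) :=
  mxsub (@enum_val _ (mem (P i))) (@enum_val _ (mem (P j))) A.

Definition cell_incl (i : 'I_k) : 'M[C]_(N, #|P i|) :=
  \matrix_(u, a) (u == enum_val a)%:R.

Definition block_diag (B : forall i : 'I_k, 'M[C]_#|P i|) : 'M[C]_N :=
  \sum_i cell_incl i *m B i *m (cell_incl i)^T.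

Definition Wmx w : 'M[C]_(N, k) :=
  \matrix_(v, i) (if v \in P i then w v 0 else 0).

Definition admissible w : Prop := forall i : 'I_k, 0 < vnorm (subvec w i).

Definition gram w : 'M[C]_k := (Wmx w) ^t* *m Wmx w.

Definition quotient A w (alpha : R) : 'M[C]_k :=
  diag_pow (gram w) (- ((1 - alpha) / 2)) *m (Wmx w) ^t* *m A *m Wmx w
    *m diag_pow (gram w) (- ((1 + alpha) / 2)).

Definition Tminus A w : 'M[C]_(N, k) :=
  (A *m Wmx w - Wmx w *m quotient A w (- 1)) *m diag_pow (gram w) (- (1 / 2)).

Definition Tplus A w : 'M[C]_(N, k) :=
  (A ^t* *m Wmx w - Wmx w *m (quotient A w 1) ^t*)
    *m diag_pow (gram w) (- (1 / 2)).

Definition Hmx w b : 'M[C]_N :=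
  block_diag (fun i => householder (subvec w i) (b 0 i)).

Definition Atilde A w b : 'M[C]_N := (Hmx w b) ^t* *m A *m Hmx w b.

Definition Omega : 'M[C]_N := perm_mx (Omega_perm P).

Definition Ahat A w b : 'M[C]_N := Omega ^t* *m Atilde A w b *m Omega.

End Quotient.

End HouseholderQuotient.

(* Main.v *)
Require Import Defs.
From mathcomp Require Import all_boot all_order all_algebra.
From mathcomp Require Import sesquilinear spectral complex reals.
From mathcomp Require Import perm exp ring.
Import Order.TTheory GRing.Theory Num.Theory.
Local Open Scope ring_scope.
Local Open Scope sesquilinear_scope.

(* The matrix U = H Omega is unitary and Ahat = U^* A U. Its first k columns are
   Q = W (W^* W)^(-1/2) V, since the Householder matrix of a cell sends the first
   basis vector to the normalized weight vector times beta_i. Hence E = Q^* A Q is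
   V^* E^0 V, while the deviation matrix is T^- = (1 - Q Q^* ) A Q V^*, so that
   T^-^* T^- is conjugate by V to D^-^* D^- = Q^* A^* (1 - Q Q^* ) A Q. The claim
   on D^+ is the one on D^- for A^*. *)

(** * Conjugate transposes and rank-one unitary matrices *)

Lemma trmxC_mul {C : numClosedFieldType} {m n p : nat}
    (A : 'M[C]_(m, n)) (B : 'M[C]_(n, p)) :
  (A *m B) ^t* = B ^t* *m A ^t*.
Proof. by rewrite trmx_mul map_mxM. Qed.

Lemma trmxC1 {C : numClosedFieldType} (n : nat) :
  (1%:M : 'M[C]_n) ^t* = 1%:M.
Proof. by rewrite trmx1 map_mx1. Qed.

Lemma unitarymx_trmxC_mul {C : numClosedFieldType} {n : nat} {U : 'M[C]_n} :
  U \is unitarymx -> U ^t* *m U = 1%:M.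
Proof. by rewrite -trmxC_unitary => /unitarymxP; rewrite trmxCK. Qed.

(* For d = c^-1, the identity c + c^* + |c|^2 y^* y = 0 that makes 1 + c y y^*
   unitary reads y^* y = - (d + d^* ). *)
Lemma rank1_unitarymx {C : numClosedFieldType} {n : nat} (y : 'cV[C]_n) (d : C) :
  d != 0 -> y ^t* *m y = (- (d + d^*))%:M ->
  1%:M + d^-1 *: (y *m y ^t*) \is unitarymx.
Proof.
move=> d0 yy; apply/unitarymxP.
have dc0 : d^* != 0 by rewrite conjC_eq0.
set Y := y *m y ^t*.
have YY : Y *m Y = - (d + d^*) *: Y.
  by rewrite /Y mulmxA -(mulmxA y) yy mul_mx_scalar -scalemxAl.
have Yt : Y ^t* = Y by rewrite trmxC_mul trmxCK.
have -> : (1%:M + d^-1 *: Y) ^t* = 1%:M + (d^-1)^* *: Y.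
  rewrite -{2}Yt; apply/matrixP => i j.
  by rewrite !mxE rmorphD rmorphM /= rmorph_nat eq_sym.
rewrite mulmxDl mulmxDr mulmxDr !mul1mx mulmx1 -scalemxAl -scalemxAr YY !scalerA.
rewrite -addrA -!scalerDl fmorphV.
suff -> : (d^*)^-1 + (d^-1 + d^-1 * (d^*)^-1 * - (d + d^*)) = 0.
  by rewrite scale0r addr0.
by field; apply/andP.
Qed.

(** * Householder matrices *)

Section Householder.
Context {R : realType}.
Local Notation C := R[i].

Lemma trmxC_mul_vnorm {n : nat} (x : 'cV[C]_n) : x ^t* *m x = (vnorm x ^+ 2)%:M.
Proof.
apply/matrixP => i j; rewrite !ord1 !mxE eqxx mulr1n sqrtCK.
by apply: eq_bigr => a _; rewrite !mxE normCK mulrC.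
Qed.

(** Outside the identity case, [rank1_unitarymx] applies with [d = r * b^* * ((x 0 0)^* - r * b)],
    where [r] is the norm of [x]. The image of the first basis vector follows from
    [y^* f = (x 0 0)^* - r * b], which cancels a factor of [d]. *)
Lemma householderP {n : nat} (x : 'cV[C]_n) (b : C) :
  0 < vnorm x -> `|b| = 1 ->
  householder x b \is unitarymx /\
  householder x b *m fvec R n = (b / vnorm x) *: x.
Proof.
case: n x => [|n] x x_gt0 b1.
  by move: x_gt0; rewrite /vnorm big_ord0 sqrtC0 ltxx.
set r := vnorm x in x_gt0 *.
have r0 : r != 0 by rewrite gt_eqF.
have rc : r^* = r by apply/CrealP/ger0_real/ltW.
have bb : b * b^* = 1 by rewrite -normCK b1 expr1n.
have bc0 : b^* != 0 by apply: contra_eq_neq bb => ->; rewrite mulr0 eq_sym oner_eq0.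
have b0 : b != 0 by rewrite -conjC_eq0.
rewrite /householder -/r; case: eqP => [xE|/eqP xN].
  split; first by apply/unitarymxP; rewrite trmxC1 mulmx1.
  by rewrite mul1mx -scalerA xE scalerA bb scale1r.
set f := fvec R n.+1 in xN *; rewrite /=.
set y := x - _.
have ff : f ^t* *m f = 1%:M.
  apply/matrixP => i j; rewrite !ord1 !mxE eqxx (bigD1 ord0) //= !mxE eqxx.
  rewrite rmorph_nat mulr1 big1 ?addr0 // => a a0.
  by rewrite !mxE -(inj_eq val_inj) in a0 *; rewrite (negbTE a0) mulr0.
have xf : x ^t* *m f = ((x 0 0)^*)%:M.
  apply/matrixP => i j; rewrite !ord1 !mxE eqxx (bigD1 ord0) //= !mxE eqxx.
  rewrite mulr1 big1 ?addr0 // => a a0.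
  by rewrite !mxE -(inj_eq val_inj) in a0 *; rewrite (negbTE a0) mulr0.
have fx : f ^t* *m x = (x 0 0)%:M.
  rewrite -[_ *m _]trmxCK trmxC_mul trmxCK xf.
  by apply/matrixP => i j; rewrite !ord1 !mxE eqxx conjCK.
have xx := trmxC_mul_vnorm x; rewrite -/r in xx.
have yt : y ^t* = x ^t* - (r * b) *: f ^t*.
  apply/matrixP => i j; rewrite !mxE rmorphB !rmorphM /= rc conjCK.
  by rewrite rmorph_nat.
have yf : y ^t* *m f = ((x 0 0)^* - r * b)%:M.
  by rewrite yt mulmxBl -scalemxAl ff xf scale_scalar_mx mulr1 -raddfB.
have yy : y ^t* *m y =
    (- (r * b^* * ((x 0 0)^* - r * b) + (r * b^* * ((x 0 0)^* - r * b))^* ))%:M.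
  rewrite {2}/y mulmxBr -scalemxAr yf yt mulmxBl -scalemxAl fx xx.
  rewrite !scale_scalar_mx -!raddfB /=; congr (_%:M).
  rewrite !rmorphM rmorphB rmorphM /= rc !conjCK.
  (* This is where [|b| = 1] enters: [r ^+ 2] is traded for [r ^+ 2 * (b * b^* )], the term produced
     by the denominator and its conjugate. *)
  have -> : r ^+ 2 - r * b * x 0 0 - r * b^* * ((x 0 0)^* - r * b) =
     r ^+ 2 - r ^+ 2 * (b * b^* ) + (r ^+ 2 * (b * b^* ) - r * b * x 0 0
        - r * b^* * ((x 0 0)^* - r * b)) by ring.
  rewrite bb; ring: bb.
(* If this factor vanished, then [y^* y = 0], so [y = 0] and [x] would fall under the case already
   treated. *)
have x1 : (x 0 0)^* - r * b != 0.
  apply: contra xN => /eqP x1.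
  suff y0 : y = 0.
    by move/eqP: y0; rewrite subr_eq0 => /eqP ->; rewrite scalerA mulKf.
  move: yy; rewrite x1 mulr0 rmorph0 addr0 oppr0 => yy.
  apply/matrixP => i j; rewrite ord1 mxE.
  move/matrixP/(_ 0 0): yy; rewrite !mxE eqxx mulr1n => /eqP.
  rewrite psumr_eq0 => [/allP/(_ i)|a _]; last by rewrite !mxE mulrC mul_conjC_ge0.
  by rewrite mem_index_enum !mxE mulrC mul_conjC_eq0 => /(_ isT)/eqP.
split; first by apply: rank1_unitarymx => //; rewrite !mulf_neq0.
rewrite mulmxDl mul1mx -scalemxAl -mulmxA yf mul_mx_scalar scalerA.
(* The inverse of [b^*] is [b], so [y] gets the coefficient [b / r], which turns the multiple of [f]
   subtracted in [y] into [f] itself. *)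
have -> : (r * b^* * ((x 0 0)^* - r * b))^-1 * ((x 0 0)^* - r * b) = b / r.
  rewrite invfM divfK // invfM mulrC; congr (_ / _).
  by apply: (mulIf bc0); rewrite mulVf.
rewrite /y scalerBr scalerA.
have -> : b / r * (r * b^*) = 1 by rewrite mulrA divfK.
by rewrite scale1r addrC subrK.
Qed.
End Householder.

(** * Similarity and compression by a unitary matrix *)

(** Over polynomials, [P (X - A) = (X - B) P], and the determinant of [P] is a nonzero constant that
    cancels. *)
Lemma char_poly_similar {F : fieldType} {n : nat} (P A B : 'M[F]_n) :
  P \in unitmx -> P *m A = B *m P -> char_poly A = char_poly B.
Proof.
move=> Pu PA; pose Q := map_mx polyC P.
have Q0 : \det Q != 0 by rewrite det_map_mx polyC_eq0 -unitfE -unitmxE.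
apply: (mulfI Q0); rewrite [RHS]mulrC -!det_mulmx; congr (\det _).
by rewrite mulmxBr mulmxBl -!map_mxM PA scalar_mxC.
Qed.

(** [Q] is the first [k] columns of [U], so [U^* A Q] is the column of [E] over [D]. Its Gram matrix
    [E^* E + D^* D] equals [Q^* A^* A Q] because [U U^* = 1]; removing [E^* E] with [E = Q^* A Q]
    leaves the projection [1 - Q Q^*] in the middle. *)
Lemma compression_of_block {C : numClosedFieldType} {k m N : nat} (e : (k + m)%N = N)
    (A U : 'M[C]_N) (E : 'M[C]_k) (D D' : 'M[C]_(m, k)) (F : 'M[C]_m)
    (Q : 'M[C]_(N, k)) :
  U \is unitarymx ->
  Q = U *m castmx (e, erefl k) (col_mx 1%:M 0) ->
  U ^t* *m A *m U = castmx (e, e) (block_mx E (D' ^t*) D F) ->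
  [/\ Q ^t* *m Q = 1%:M, E = Q ^t* *m A *m Q &
      D ^t* *m D = Q ^t* *m A ^t* *m (1%:M - Q *m Q ^t*) *m A *m Q].
Proof.
(* Since [N] is a variable, eliminating [e] replaces it by [k + m], and the casts become
   identities. *)
case: N / e A U Q => A U Q Uu; rewrite !castmx_id => QE UAU.
have UU := unitarymx_trmxC_mul Uu; have UU' := unitarymxP Uu.
set L : 'M[C]_(k + m, k) := col_mx 1%:M 0 in QE.
have Lt : L ^t* = row_mx 1%:M 0.
  by rewrite /L tr_col_mx map_row_mx trmxC1 trmx0 map_mx0.
have Qt : Q ^t* = L ^t* *m U ^t* by rewrite QE trmxC_mul.
have UAQ : U ^t* *m A *m Q = col_mx E D.
  by rewrite QE !mulmxA UAU mul_block_col !mulmx1 !mulmx0 !addr0.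
have EE : Q ^t* *m A *m Q = E.
  by rewrite Qt -!mulmxA (mulmxA _ A) UAQ Lt mul_row_col mul1mx mul0mx addr0.
split=> //.
  by rewrite Qt QE !mulmxA -(mulmxA _ _ U) UU mulmx1 Lt mul_row_col mul1mx mul0mx addr0.
have := congr1 (fun M => M ^t* *m M) UAQ.
rewrite tr_col_mx map_row_mx mul_row_col -{2}EE -{1}EE !trmxC_mul !trmxCK.
rewrite !mulmxA -(mulmxA _ U) UU' mulmx1 => eqD.
apply: (addrI (Q ^t* *m A ^t* *m Q *m Q ^t* *m A *m Q)); rewrite -eqD.
by rewrite mulmxBr !mulmxBl !mulmxA mulmx1 addrC subrK.
Qed.

(** * First index of a cell and its image under the permutation *)

Section Cells.
Context {N k : nat} (P : ordered_partition N k).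

(** [enum A] is a subsequence of the increasing enumeration of all indices, so its head is the
    minimum. *)
Lemma enum_val_min (A : {set 'I_N}) (a : 'I_#|A|) (v : 'I_N) :
  a = 0%N :> nat -> v \in A -> (enum_val a <= v)%N.
Proof.
move=> a0 vA; rewrite (enum_val_nth v) a0.
have : sorted ltn (map val (enum A)).
  rewrite /enum_mem (subseq_sorted ltn_trans (s2 := map val (Finite.enum 'I_N))) //.
    by rewrite map_subseq // filter_subseq.
  by rewrite -enumT val_enum_ord iota_ltn_sorted.
have : v \in enum A by rewrite mem_enum.
case: (enum A) => // x s /=; rewrite inE => /predU1P[-> //|vs].
by move/(order_path_min ltn_trans)/allP/(_ _ (map_f val vs))/ltnW.
Qed.

Lemma enum_val_cell_start (i : 'I_k) (a : 'I_#|P i|) :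
  a = 0%N :> nat -> enum_val a = cell_start P i :> nat.
Proof.
move=> a0; have ui := enum_valP a; set u := enum_val a in ui *.
have := cell_of_bounds P u; rewrite (cell_ofE ui) => /andP[le _].
pose v := Ordinal (leq_ltn_trans le (ltn_ord u)).
(* As [v <= u], its cell is [i] or an earlier one, and the indices of an earlier cell lie below
   [cell_start P i]. *)
have vi : v \in P i.
  have := cell_of_mono P (u := v) (v := u) le; rewrite (cell_ofE ui) leq_eqVlt.
  case/predU1P => [/val_inj <-|lt]; first exact: mem_cell_of.
  have /andP[_] := cell_of_bounds P v.
  by rewrite ltnNge (cell_start_mono P lt).
by apply/eqP; rewrite eqn_leq le andbT; exact: (@enum_val_min _ a v).
Qed.

(** An index that does not start its cell is sent to a value at least [k], a start to the number of
    its cell. This determines the first [k] columns of [Omega]. *)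
Lemma Omega_perm_cell (u : 'I_N) (i : 'I_k) :
  (Omega_perm P u == i :> nat) = (u == cell_start P i :> nat).
Proof.
rewrite permE /= /Omega_nat.
case: (eqVneq (u : nat) (cell_start P (cell_of P u))) => [uE|uN]; last first.
  have := Omega_nat_ge uN => le.
  rewrite (gtn_eqF (leq_trans (ltn_ord i) le)); apply/esym/eqP => uE.
  have := enum_val_cell_start i (Ordinal (cell_neq0 P i)) erefl.
  rewrite -uE => /val_inj uE'; have ui := enum_valP (Ordinal (cell_neq0 P i)).
  by case/negP: uN; rewrite -uE' (cell_ofE ui) uE' uE.
apply/eqP/eqP => [/val_inj <- //|uE'].
have := enum_val_cell_start i (Ordinal (cell_neq0 P i)) erefl.
rewrite -uE' => /val_inj <-.
by rewrite (cell_ofE (enum_valP (Ordinal (cell_neq0 P i)))).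
Qed.
End Cells.

(** * Cell inclusions and block-diagonal matrices *)

Section Quotients.
Context {R : realType} {N k : nat} (P : ordered_partition N k).
Local Notation C := R[i].
Local Notation J := (cell_incl R P).

Lemma cell_inclT (i : 'I_k) : (J i) ^t* = (J i)^T.
Proof. by apply/matrixP => a u; rewrite !mxE rmorph_nat. Qed.

Lemma cell_incl_mulmx (i : 'I_k) {n : nat} (M : 'M[C]_(N, n)) :
  (J i)^T *m M = rowsub (@enum_val _ (mem (P i))) M.
Proof.
apply/matrixP => a j; rewrite !mxE (bigD1 (enum_val a)) //= !mxE eqxx mul1r.
by rewrite big1 ?addr0 // => u /negbTE ua; rewrite !mxE ua mul0r.
Qed.

Lemma mulmx_cell_incl (j : 'I_k) {m : nat} (M : 'M[C]_(m, N)) :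
  M *m J j = colsub (@enum_val _ (mem (P j))) M.
Proof.
apply: trmx_inj; rewrite trmx_mul cell_incl_mulmx.
by apply/matrixP => a b; rewrite !mxE.
Qed.

Lemma blockE (A : 'M[C]_N) (i j : 'I_k) : block P A i j = (J i)^T *m A *m J j.
Proof.
by rewrite mulmx_cell_incl cell_incl_mulmx; apply/matrixP => a b; rewrite !mxE.
Qed.

Lemma cell_incl_unitary (i : 'I_k) : (J i)^T *m J i = 1%:M.
Proof.
rewrite cell_incl_mulmx; apply/matrixP => a b.
by rewrite !mxE (inj_eq enum_val_inj).
Qed.

Lemma cell_incl_orthogonal (i j : 'I_k) : i != j -> (J i)^T *m J j = 0.
Proof.
move=> ij; rewrite cell_incl_mulmx; apply/matrixP => a b; rewrite !mxE.
case: eqP => // ab; case/eqP: ij.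
by apply: (cell_disj (enum_valP a)); rewrite ab enum_valP.
Qed.

Lemma mulmx_cell_inclT (i : 'I_k) :
  J i *m (J i)^T = diag_mx (\row_u (u \in P i)%:R).
Proof.
apply/matrixP => u v; rewrite !mxE; have [ui|ui] := boolP (u \in P i).
  rewrite (bigD1 (enum_rank_in ui u)) //= !mxE enum_rankK_in // eqxx mul1r eq_sym.
  rewrite big1 ?addr0 // => a aN; rewrite !mxE; case: eqP => [ua|]; last by rewrite mul0r.
  by case/eqP: aN; apply: enum_val_inj; rewrite enum_rankK_in.
rewrite mul0rn big1 // => a _; rewrite !mxE; case: eqP => [ua|]; last by rewrite mul0r.
by case/negP: ui; rewrite ua; exact: enum_valP.
Qed.

(** The cells cover all indices without overlap, so the coordinate projections onto them add up to
    the identity. *)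
Lemma sum_cell_incl : \sum_i J i *m (J i)^T = 1%:M.
Proof.
rewrite (eq_bigr _ (fun i _ => mulmx_cell_inclT i)).
apply/matrixP => u v; rewrite summxE !mxE.
rewrite (bigD1 (cell_of P u)) //= !mxE mem_cell_of big1 ?addr0 // => i iN.
rewrite !mxE; have [ui|_] := boolP (u \in P i); last by rewrite mul0rn.
by rewrite (cell_ofE ui) eqxx in iN.
Qed.

Section BlockDiag.
Context (B : forall i : 'I_k, 'M[C]_#|P i|).

(** Orthogonality of the inclusions kills every summand but the [j]-th. Moving [J j] through
    [block_diag B] is how blocks of products are computed. *)
Lemma block_diag_incl (j : 'I_k) : block_diag B *m J j = J j *m B j.
Proof.
rewrite mulmx_suml (bigD1 j) //= -!mulmxA cell_incl_unitary mulmx1.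
rewrite big1 ?addr0 // => i ij.
by rewrite -!mulmxA cell_incl_orthogonal // !mulmx0.
Qed.

Lemma block_diag_unitary :
  (forall i, B i \is unitarymx) -> block_diag B \is unitarymx.
Proof.
move=> Bu; apply/unitarymxP.
have -> : (block_diag B) ^t* = \sum_i J i *m (B i) ^t* *m (J i)^T.
  rewrite /block_diag !raddf_sum /=; apply: eq_bigr => i _.
  rewrite 2!trmxC_mul cell_inclT mulmxA; congr (_ *m _ *m _).
  by rewrite -cell_inclT trmxCK.
rewrite mulmx_sumr -sum_cell_incl; apply: eq_bigr => i _.
by rewrite !mulmxA block_diag_incl -(mulmxA (J i)) (unitarymxP (Bu i)) mulmx1.
Qed.
End BlockDiag.

Lemma block_conj_block_diag (B : forall i : 'I_k, 'M[C]_#|P i|) (A : 'M[C]_N)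
    (i j : 'I_k) :
  block P ((block_diag B) ^t* *m A *m block_diag B) i j =
    (B i) ^t* *m block P A i j *m B j.
Proof.
rewrite !blockE -!mulmxA block_diag_incl !mulmxA.
rewrite -[X in X *m _ *m _ *m _]trmxCK trmxC_mul trmxCK -cell_inclT trmxCK.
by rewrite block_diag_incl trmxC_mul.
Qed.

(** * Gram matrix, quotients and deviation matrices *)

Context (w : 'cV[C]_N).
Local Notation W := (Wmx P w).
Local Notation wnorm i := (vnorm (subvec P w i)).

Lemma col_Wmx (i : 'I_k) : col i W = J i *m subvec P w i.
Proof.
rewrite /subvec -cell_incl_mulmx mulmxA mulmx_cell_inclT mul_diag_mx.
apply/matrixP => u j; rewrite ord1 !mxE.
by case: (u \in P i); rewrite ?mul1r ?mul0r.
Qed.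

Lemma gramE : gram P w = diag_mx (\row_i wnorm i ^+ 2).
Proof.
apply/matrixP => i j.
have -> : gram P w i j = ((col i W) ^t* *m col j W) 0 0.
  by rewrite !mxE; apply: eq_bigr => u _; rewrite !mxE.
rewrite !col_Wmx trmxC_mul cell_inclT mulmxA -(mulmxA _ _ (J j)).
have [<-|ij] := eqVneq i j; last first.
  by rewrite cell_incl_orthogonal // mulmx0 mul0mx !mxE (negbTE ij).
by rewrite cell_incl_unitary mulmx1 trmxC_mul_vnorm !mxE !eqxx.
Qed.

Context (w_adm : admissible P w).

(** The diagonal of [(W^* W)^(-1/2)], which normalizes the columns of [W]. *)
Definition wnormV : 'rV[C]_k := \row_i (wnorm i)^-1.

Lemma wnormV_real : (diag_mx wnormV) ^t* = diag_mx wnormV.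
Proof.
rewrite tr_diag_mx map_diag_mx; congr diag_mx; apply/rowP => i; rewrite !mxE.
by apply/CrealP; rewrite rpredV ger0_real // ltW.
Qed.

Lemma wnorm_Re (i : 'I_k) : real_complex R (complex.Re (wnorm i)) = wnorm i.
Proof. by apply: RRe_real; apply/ger0_real/ltW. Qed.

Lemma diag_pow_gram (s : R) : diag_pow (gram P w) s =
  diag_mx (\row_i real_complex R ((complex.Re (wnorm i) ^+ 2) `^ s)).
Proof.
rewrite /diag_pow gramE; congr diag_mx; apply/rowP => i.
by rewrite !mxE eqxx mulr1n -{1}wnorm_Re -rmorphXn.
Qed.

Lemma gram_pow0 : diag_pow (gram P w) 0 = 1%:M.
Proof.
rewrite diag_pow_gram -diag_const_mx; congr diag_mx; apply/rowP => i.
by rewrite !mxE powRr0.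
Qed.

Lemma gram_powN12 : diag_pow (gram P w) (- (1 / 2)) = diag_mx wnormV.
Proof.
rewrite diag_pow_gram; congr diag_mx; apply/rowP => i; rewrite !mxE.
rewrite powRN div1r powR12_sqrt ?sqr_ge0 // sqrtr_sqr ger0_norm.
  by rewrite fmorphV /= wnorm_Re.
by rewrite -ler0c wnorm_Re ltW.
Qed.

Lemma gram_powN1 : diag_pow (gram P w) (- 1) = diag_mx wnormV *m diag_mx wnormV.
Proof.
rewrite diag_pow_gram mulmx_diag; congr diag_mx; apply/rowP => i; rewrite !mxE.
by rewrite powR_inv1 ?sqr_ge0 // fmorphV rmorphXn /= wnorm_Re expr2 invfM.
Qed.

Lemma rayleighE (A : 'M[C]_N) :
  quotient P A w 0 = diag_mx wnormV *m W ^t* *m A *m W *m diag_mx wnormV.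
Proof. by rewrite /quotient subr0 addr0 gram_powN12. Qed.

(** For [alpha = -1] the two exponents are [-1] and [0], so with [S = diag_mx wnormV] one gets
    [W E^- = W S (W S)^* A W]. *)
Lemma TminusE (A : 'M[C]_N) : Tminus P A w =
  (1%:M - W *m diag_mx wnormV *m (W *m diag_mx wnormV) ^t* ) *m A *m W *m diag_mx wnormV.
Proof.
rewrite /Tminus /quotient gram_powN12.
have -> : - ((1 - - 1) / 2) = - 1 :> R by field.
have -> : - ((1 + - 1) / 2) = 0 :> R by field.
rewrite gram_powN1 gram_pow0 mulmx1 trmxC_mul wnormV_real.
by rewrite ![(1%:M - _) *m _]mulmxBl mul1mx !mulmxBl !mulmxA.
Qed.

(** The adjoint of [E^+] for [A] is [E^-] for [A^*]: the self-adjoint inverse Gram matrix moves from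
    the right of the product to its left. *)
Lemma Tplus_Tminus (A : 'M[C]_N) : Tplus P A w = Tminus P (A ^t* ) w.
Proof.
rewrite /Tplus /Tminus /quotient.
have -> : - ((1 - - 1) / 2) = - 1 :> R by field.
have -> : - ((1 + - 1) / 2) = 0 :> R by field.
have -> : - ((1 + 1) / 2) = - 1 :> R by field.
rewrite gram_powN1 gram_pow0 mulmx1 mul1mx !trmxC_mul trmxCK wnormV_real.
by rewrite !mulmxA.
Qed.

(** * The unitary matrix [H Omega] and its first columns *)

Lemma Omega_first_cols :
  Omega R P *m castmx (cells_addK P, erefl k) (col_mx 1%:M 0) =
  \matrix_(u, i) (u == cell_start P i :> nat)%:R.
Proof.
rewrite -row_permE; apply/matrixP => u i.
rewrite !mxE castmxE cast_ord_id !mxE -(Omega_perm_cell P u i).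
by case: splitP => j /= ->; rewrite !mxE // gtn_eqF // ltn_addr.
Qed.

Lemma cell_incl_fvec (i : 'I_k) :
  J i *m fvec R #|P i| = \col_u (u == cell_start P i :> nat)%:R.
Proof.
apply/matrixP => u j; pose a := Ordinal (cell_neq0 P i).
rewrite !mxE (bigD1 a) //= !mxE mulr1 big1 ?addr0 => [|b ba]; last first.
  by rewrite !mxE -(inj_eq val_inj) in ba *; rewrite (negbTE ba) mulr0.
by rewrite -(inj_eq val_inj) /= (enum_val_cell_start P i a erefl).
Qed.

Context (beta : 'rV[C]_k) (beta1 : forall i, `|beta 0 i| = 1).

Lemma Hmx_unitary : Hmx P w beta \is unitarymx.
Proof.
apply: block_diag_unitary => i.
by case: (householderP _ _ (w_adm i) (beta1 i)).
Qed.

Lemma Hmx_Omega_unitary : Hmx P w beta *m Omega R P \is unitarymx.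
Proof.
apply: mul_unitarymx; first exact: Hmx_unitary.
apply/unitarymxP; rewrite /Omega tr_perm_mx map_perm_mx -perm_mxM.
by rewrite mulgV perm_mx1.
Qed.

Lemma AhatE (A : 'M[C]_N) : Ahat P A w beta =
  (Hmx P w beta *m Omega R P) ^t* *m A *m (Hmx P w beta *m Omega R P).
Proof. by rewrite /Ahat /Atilde trmxC_mul !mulmxA. Qed.

(** For [i < k], column [i] of [Omega] is [J i] applied to the first basis vector; [block_diag_incl]
    brings [H] inside the cell, where [householderP] applies. *)
Lemma Hmx_Omega_first_cols :
  W *m diag_mx wnormV *m diag_mx beta =
  Hmx P w beta *m Omega R P *m castmx (cells_addK P, erefl k) (col_mx 1%:M 0).
Proof.
rewrite -[RHS]mulmxA Omega_first_cols.
apply/matrixP => u i; have [_ Hf] := householderP _ _ (w_adm i) (beta1 i).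
transitivity ((Hmx P w beta *m (J i *m fvec R #|P i|)) u 0); last first.
  by rewrite cell_incl_fvec !mxE; apply: eq_bigr => v _; rewrite !mxE.
rewrite (mulmxA (Hmx P w beta)) block_diag_incl -(mulmxA (J i)) Hf -scalemxAr -col_Wmx.
by rewrite -mulmxA mulmx_diag mul_mx_diag !mxE; ring.
Qed.

End Quotients.

(** * Singular values through Gram matrices, and the theorem *)

(** The row counts may differ, since only the [n] by [n] Gram matrices matter. They are conjugate by
    [V], hence have one characteristic polynomial, from which the list of eigenvalues is computed;
    so the lists agree even in order. *)
Lemma eq_singular_values {R : realType} {m m' n : nat}
    (D : 'M[R[i]]_(m, n)) (T : 'M[R[i]]_(m', n)) (V : 'M[R[i]]_n) :
  V \is unitarymx -> T ^t* *m T = V *m (D ^t* *m D) *m V ^t* ->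
  singular_values D = singular_values T.
Proof.
move=> Vu TD; rewrite /singular_values /eigenvalues.
rewrite (char_poly_similar V (D ^t* *m D) (T ^t* *m T)) ?unitarymx_unit //.
by rewrite TD -[RHS]mulmxA unitarymx_trmxC_mul // mulmx1.
Qed.

(** Orthonormal columns of [Q] make [1 - Q Q^*] a self-adjoint idempotent, so its two occurrences in
    [T^* T] merge. *)
Lemma projection_gram {C : numClosedFieldType} {N k : nat} (A : 'M[C]_N)
    (Q : 'M[C]_(N, k)) :
  Q ^t* *m Q = 1%:M ->
  let T := (1%:M - Q *m Q ^t* ) *m A *m Q in
  T ^t* *m T = Q ^t* *m A ^t* *m (1%:M - Q *m Q ^t* ) *m A *m Q.
Proof.
move=> QQ /=; set X := 1%:M - _.
have Xt : X ^t* = X.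
  by rewrite /X !raddfB /= trmxC1 trmxC_mul trmxCK.
have XX : X *m X = X.
  rewrite {1}/X mulmxBl mul1mx /X mulmxBr mulmx1 !mulmxA.
  by rewrite -(mulmxA Q _ Q) QQ mulmx1 subrr subr0.
by rewrite !trmxC_mul Xt !mulmxA -(mulmxA _ X X) XX.
Qed.

Theorem theorem1 (R : realType) (N k : nat) (P : ordered_partition N k)
    (A : 'M[R[i]]_N) (w : 'cV[R[i]]_N) (beta : 'rV[R[i]]_k)
    (E : 'M[R[i]]_k) (Dplus Dminus : 'M[R[i]]_(N - k, k)) (F : 'M[R[i]]_(N - k)) :
  admissible P w ->
  diag_mx beta \is unitarymx ->
  Ahat P A w beta =
    castmx (cells_addK P, cells_addK P) (block_mx E (Dplus ^t*) Dminus F) ->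
  [/\ forall i j : 'I_k,
        block P (Atilde P A w beta) i j =
          (householder (subvec P w i) (beta 0 i)) ^t* *m block P A i j
            *m householder (subvec P w j) (beta 0 j),
      simmx_in unitarymx (Ahat P A w beta) A,
      simmx_in unitarymx E (quotient P A w 0),
      perm_eq (singular_values Dminus) (singular_values (Tminus P A w)) /\
      perm_eq (singular_values Dplus) (singular_values (Tplus P A w))
    & forall (lambda : R[i]) (zhat : 'cV[R[i]]_N),
        zhat != 0 -> Ahat P A w beta *m zhat = lambda *: zhat ->
        let z := Hmx P w beta *m Omega R P *m zhat in
        z != 0 /\ A *m z = lambda *: z].
Proof.
move=> w_adm Vu AhatB.
have beta1 i : `|beta 0 i| = 1.
  have /matrixP/(_ i i) := unitarymxP Vu.
  rewrite tr_diag_mx map_diag_mx mulmx_diag !mxE !eqxx !mulr1n -normCK => b1.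
  by apply/eqP; rewrite -(@pexpr_eq1 _ _ 2) // b1.
have Uu := Hmx_Omega_unitary P w w_adm beta beta1.
set U := Hmx P w beta *m Omega R P in Uu *.
have UU := unitarymx_trmxC_mul Uu; have UU' := unitarymxP Uu.
have QE := Hmx_Omega_first_cols P w w_adm beta beta1.
rewrite -/U in QE; set S := diag_mx (wnormV P w) in QE.
set V := diag_mx beta in Vu QE; set Q := _ *m V in QE.
have VV := unitarymxP Vu.
have QV : Wmx P w *m S = Q *m V ^t* by rewrite -mulmxA VV mulmx1.
have QQt : Wmx P w *m S *m (Wmx P w *m S) ^t* = Q *m Q ^t*.
  by rewrite QV trmxC_mul trmxCK mulmxA -(mulmxA _ _ V) unitarymx_trmxC_mul // mulmx1.
have AE := AhatE P w beta A; rewrite -/U in AE.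
(* Stated for an arbitrary [B] because it serves both [A] and [A^*]. *)
have sv (B E' F' : 'M_ _) (D D' : 'M[R[i]]_(N - k, k)) :
    U ^t* *m B *m U = castmx (cells_addK P, cells_addK P) (block_mx E' (D' ^t*) D F') ->
    perm_eq (singular_values D) (singular_values (Tminus P B w)).
  case/(compression_of_block _ _ _ _ _ _ _ _ Uu QE) => Q1 _ DD.
  suff TT : (Tminus P B w) ^t* *m Tminus P B w = V *m (D ^t* *m D) *m V ^t*.
    by rewrite (eq_singular_values _ _ _ Vu TT) perm_refl.
  (* By [W S = Q V^*], the deviation matrix is [(1 - Q Q^* ) B Q V^*], whose Gram matrix is the one
     of [projection_gram] conjugated by [V]. *)
  rewrite DD -(projection_gram B Q Q1) (TminusE _ _ w_adm) -/S QQt.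
  rewrite -(mulmxA _ (Wmx P w)) QV !mulmxA.
  by rewrite trmxC_mul trmxCK.
have [_ EE _] := compression_of_block _ _ _ _ _ _ _ _ Uu QE (etrans (esym AE) AhatB).
split.
- by move=> i j; exact: block_conj_block_diag.
- exists U; first exact: Uu.
   apply: simmxW; first by rewrite row_free_unit unitarymx_unit.
  by rewrite AE !mulmxA UU' mul1mx.
- exists V; first exact: Vu.
   apply: simmxW; first by rewrite row_free_unit unitarymx_unit.
  have St : S ^t* = S := wnormV_real P w w_adm.
  (* [E^0 = (W S)^* A (W S) = V Q^* A Q V^* = V E V^*]. *)
  rewrite EE (rayleighE _ _ w_adm) -/S -{1}St -trmxC_mul -(mulmxA _ (Wmx P w) S).
  rewrite QV (trmxC_mul Q) trmxCK !mulmxA.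
  by rewrite -[RHS]mulmxA unitarymx_trmxC_mul // mulmx1.
- split; first by apply: (sv _ _ _ _ _ (etrans (esym AE) AhatB)).
  rewrite (Tplus_Tminus _ _ w_adm).
  (* The adjoint of the block form exchanges the off-diagonal blocks, which puts [Dplus] in the
     lower left position for [A^*]. *)
  apply: (sv _ (E ^t*) (F ^t*) _ Dminus).
  have := congr1 (fun M => M ^t*) (etrans (esym AE) AhatB).
  rewrite (trmxC_mul _ U) (trmxC_mul _ A) trmxCK mulmxA => ->.
  by rewrite trmx_cast map_castmx tr_block_mx map_block_mx trmxCK.
- move=> lambda zhat z0 eig /=; rewrite -/U; split.
    apply: contra z0 => /eqP Uz.
    by rewrite -[zhat]mul1mx -UU -mulmxA Uz mulmx0.
  by rewrite scalemxAr -eig AE !mulmxA UU' mul1mx.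
Qed.
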